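(* Let $f:\mathbb{H}\to\mathbb{H}$, $f(x)=axb$, and $g:\mathbb{H}\to\mathbb{H}$, $g(x)=cxd$, be two simple rotations, and let $\Pi_f$ and $\Pi_g$ be the point-wise invariant planes of $f$ and $g$ respectively. Then the composition $h=g\circ f$ is a simple rotation if and only if $\Pi_f\cap\Pi_g\neq\{0\}$.
   Context: $\mathbb{H}$ is the algebra of real quaternions $x=x_0+x_1i+x_2j+x_3k$, identified with Euclidean space $\mathbb{E}^4=\mathbb{R}^4$ with its standard scalar product. Write $Sx=x_0$ (real part), $Vx=x_1i+x_2j+x_3k$ (vector part), $\bar x=Sx-Vx$ (conjugate), $Nx=x\bar x=x_0^2+x_1^2+x_2^2+x_3^2$. A unit quaternion is one with $Nx=1$. A simple rotation is a rotation of $\mathbb{E}^4$ in a plane (2-dimensional linear subspace) through some angle $\alpha$ such that all points of the orthogonal plane remain fixed; in quaternionic form, it is a map $x\mapsto axb$ with $Na=Nb=1$ and $Sa=Sb=\cos\frac{\alpha}{2}$ (the identity, with $\alpha=0$, is included as a simple rotation). For a unit quaternion $y$, $R_y(x)=-y\bar x y$ is the reflection in the hyperplane through the origin with normal $y$. Every simple rotation $f$ can be written as $f=R_z\circ R_y$, i.e. $f(x)=(z\bar y)x(\bar y z)$, for some unit quaternions $y,z$. The point-wise invariant plane of $f$ is $\Pi_f=\{x\in\mathbb{H}:\sum_{\mu=0}^3 y_\mu x_\mu=\sum_{\mu=0}^3 z_\mu x_\mu=0\}$; when $f$ is not the identity this is a 2-dimensional subspace, namely the set of all $x$ with $f(x)=x$.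 $\Pi_g$ is defined in the same way. *)

(* Defs.v *)
From HB Require Import structures.
From mathcomp Require Import all_boot all_order all_algebra.
From mathcomp Require Import ring.
From mathcomp Require Import boolp classical_sets reals trigo.

Set Implicit Arguments.
Unset Strict Implicit.
Unset Printing Implicit Defensive.

Import Order.TTheory GRing.Theory Num.Theory.
Local Open Scope classical_set_scope.
Local Open Scope ring_scope.

(* [Quat x0 x1 x2 x3] is the quaternion x0 + x1 i + x2 j + x3 k, and also the
   point (x0, x1, x2, x3) of Euclidean 4-space. *)
Record quat (R : Type) : Type :=
  Quat { q0 : R; q1 : R; q2 : R; q3 : R }.

Section Algebra.
Variable R : realType.
Implicit Types x y z : quat R.

Definition quat_to_prod x := (q0 x, q1 x, q2 x, q3 x).
Definition quat_of_prod (p : R * R * R * R) :=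
  Quat p.1.1.1 p.1.1.2 p.1.2 p.2.

Lemma quat_to_prodK : cancel quat_to_prod quat_of_prod.
Proof. by case. Qed.

HB.instance Definition _ := Choice.copy (quat R) (can_type quat_to_prodK).

Lemma quatP x y :
  q0 x = q0 y -> q1 x = q1 y -> q2 x = q2 y -> q3 x = q3 y -> x = y.
Proof. by case: x y => ? ? ? ? [? ? ? ?] /= -> -> -> ->. Qed.

Definition quat_zero : quat R := Quat 0 0 0 0.
Definition quat_opp x := Quat (- q0 x) (- q1 x) (- q2 x) (- q3 x).
Definition quat_add x y :=
  Quat (q0 x + q0 y) (q1 x + q1 y) (q2 x + q2 y) (q3 x + q3 y).

Fact quat_addA : associative quat_add.
Proof. by move=> x y z; apply: quatP => /=; ring. Qed.
Fact quat_addC : commutative quat_add.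
Proof. by move=> x y; apply: quatP => /=; ring. Qed.
Fact quat_add0 : left_id quat_zero quat_add.
Proof. by move=> x; apply: quatP => /=; ring. Qed.
Fact quat_addN : left_inverse quat_zero quat_opp quat_add.
Proof. by move=> x; apply: quatP => /=; ring. Qed.

HB.instance Definition _ :=
  GRing.isZmodule.Build (quat R) quat_addA quat_addC quat_add0 quat_addN.

Definition quat_one : quat R := Quat 1 0 0 0.

(* The bilinear product with i^2 = j^2 = k^2 = ijk = -1. *)
Definition quat_mul x y :=
  Quat (q0 x * q0 y - q1 x * q1 y - q2 x * q2 y - q3 x * q3 y)
       (q0 x * q1 y + q1 x * q0 y + q2 x * q3 y - q3 x * q2 y)
       (q0 x * q2 y - q1 x * q3 y + q2 x * q0 y + q3 x * q1 y)
       (q0 x * q3 y + q1 x * q2 y - q2 x * q1 y + q3 x * q0 y).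

Fact quat_mulA : associative quat_mul.
Proof. by move=> x y z; apply: quatP => /=; ring. Qed.
Fact quat_mul1l : left_id quat_one quat_mul.
Proof. by move=> x; apply: quatP => /=; ring. Qed.
Fact quat_mul1r : right_id quat_one quat_mul.
Proof. by move=> x; apply: quatP => /=; ring. Qed.
Fact quat_mulDl : left_distributive quat_mul (@GRing.add (quat R)).
Proof. by move=> x y z; apply: quatP => /=; ring. Qed.
Fact quat_mulDr : right_distributive quat_mul (@GRing.add (quat R)).
Proof. by move=> x y z; apply: quatP => /=; ring. Qed.
Fact quat_oner_neq0 : quat_one != 0 :> quat R.
Proof. by apply/eqP => -[] /eqP; rewrite oner_eq0. Qed.

HB.instance Definition _ := GRing.Zmodule_isNzRing.Build (quat R)
  quat_mulA quat_mul1l quat_mul1r quat_mulDl quat_mulDr quat_oner_neq0.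

Definition quat_scale (s : R) x :=
  Quat (s * q0 x) (s * q1 x) (s * q2 x) (s * q3 x).

Fact quat_scaleA s t x : quat_scale s (quat_scale t x) = quat_scale (s * t) x.
Proof. by apply: quatP => /=; ring. Qed.
Fact quat_scale1 : left_id 1 quat_scale.
Proof. by move=> x; apply: quatP => /=; ring. Qed.
Fact quat_scaleDr : right_distributive quat_scale +%R.
Proof. by move=> s x y; apply: quatP => /=; ring. Qed.
Fact quat_scaleDl x : {morph quat_scale^~ x : s t / s + t}.
Proof. by move=> s t; apply: quatP => /=; ring. Qed.

HB.instance Definition _ := GRing.Zmodule_isLmodule.Build R (quat R)
  quat_scaleA quat_scale1 quat_scaleDr quat_scaleDl.

Definition conjq x : quat R := Quat (q0 x) (- q1 x) (- q2 x) (- q3 x).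

Definition dotq x y : R :=
  q0 x * q0 y + q1 x * q1 y + q2 x * q2 y + q3 x * q3 y.

Definition normq x : R := q0 x ^+ 2 + q1 x ^+ 2 + q2 x ^+ 2 + q3 x ^+ 2.

Lemma mulq_conj x : x * conjq x = Quat (normq x) 0 0 0.
Proof. by apply: quatP; rewrite /normq /=; ring. Qed.

Definition unitq x : Prop := normq x = 1.

(* Rotation through [alpha] in the plane with orthonormal basis (u, v), every
   point w of the orthogonal plane being fixed; alpha = 0 gives the identity. *)
Definition simple_rotation (f : quat R -> quat R) : Prop :=
  exists (u v : quat R) (alpha : R),
    [/\ unitq u, unitq v, dotq u v = 0 &
        forall (s t : R) (w : quat R), dotq w u = 0 -> dotq w v = 0 ->
          f (s *: u + t *: v + w) =
            s *: (cos alpha *: u + sin alpha *: v)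
            + t *: (- sin alpha *: u + cos alpha *: v) + w].

Definition reflq (y x : quat R) : quat R := - (y * conjq x * y).

(* [P] is the point-wise invariant plane of [f] read off from some
   decomposition of [f] into two reflections. It does not depend on the
   decomposition unless [f] is the identity, in which case the equations
   define a hyperplane (then z = y or z = - y). *)
Definition invariant_plane (f : quat R -> quat R) (P : set (quat R)) : Prop :=
  exists y z : quat R,
    [/\ unitq y, unitq z, f =1 reflq z \o reflq y &
        P = [set x | dotq y x = 0 /\ dotq z x = 0]].

Lemma reflqE y x : unitq y -> reflq y x = x - (2 * dotq x y) *: y.
Proof.
move=> Ny; transitivity (normq y *: x - (2 * dotq x y) *: y).
  by apply: quatP; rewrite /normq /dotq /=; ring.
by rewrite Ny scale1r.
Qed.

Lemma invariant_plane_exists f :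
  simple_rotation f -> exists P, invariant_plane f P.
Proof.
move=> [u [v [alpha [Nu Nv uv fE]]]].
have [A [B [AB cE sE]]] : exists A B : R, [/\ A ^+ 2 + B ^+ 2 = 1,
    cos alpha = A ^+ 2 - B ^+ 2 & sin alpha = 2 * A * B].
  exists (cos (alpha / 2)), (sin (alpha / 2)).
  have e : alpha = alpha / 2 + alpha / 2 by field.
  by split; [exact: cos2Dsin2 | rewrite {1}e cosD; ring |
    rewrite {1}e sinD; ring].
have Nz : unitq (A *: u + B *: v).
  transitivity (A ^+ 2 * normq u + B ^+ 2 * normq v + 2 * A * B * dotq u v).
    by rewrite /normq /dotq /=; ring.
  by rewrite Nu Nv uv !mulr1 mulr0 addr0.
eexists; exists u, (A *: u + B *: v); split=> // x.
rewrite /comp !reflqE //; set s := dotq x u; set t := dotq x v.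
have -> : dotq (x - (2 * s) *: u) (A *: u + B *: v) = B * t - A * s.
  transitivity (A * s + B * t - 2 * s * A * normq u - 2 * s * B * dotq u v).
    by rewrite /s /t /normq /dotq /=; ring.
  by rewrite Nu uv; ring.
pose w := x - s *: u - t *: v.
have wu : dotq w u = 0.
  transitivity (dotq x u - s * normq u - t * dotq u v).
    by rewrite /w /normq /dotq /=; ring.
  by rewrite Nu uv -/s; ring.
have wv : dotq w v = 0.
  transitivity (dotq x v - t * normq v - s * dotq u v).
    by rewrite /w /normq /dotq /=; ring.
  by rewrite Nv uv -/t; ring.
have xE : x = s *: u + t *: v + w.
  by rewrite /w -(addrA x) -opprD [RHS]addrC subrK.
rewrite {1}xE fE // cE sE {xE wu wv}.
have tE : t *: v = (t * A ^+ 2 + t * B ^+ 2) *: v by rewrite -mulrDr AB mulr1.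
have sE' : s *: u = (2 * s - (s * A ^+ 2 + s * B ^+ 2)) *: u.
  by rewrite -mulrDr AB; congr (_ *: _); ring.
rewrite /w sE' tE.
by apply: quatP => /=; ring.
Qed.

End Algebra.

(* Main.v *)
From Pilot Require Import Defs.
From mathcomp Require Import all_boot all_order all_algebra.
From mathcomp Require Import classical_sets reals.
From mathcomp Require Import ring lra boolp trigo.
Set Implicit Arguments.
Unset Strict Implicit.
Unset Printing Implicit Defensive.

(* The second import makes normq the quaternion norm rather than that of rat. *)
Import Pilot.Defs Order.TTheory GRing.Theory Num.Theory.
Local Open Scope classical_set_scope.
Local Open Scope ring_scope.

(** Write f = R_z R_y and g = R_z' R_y'. Then h = g o f is x |-> p x q with
    p = z' y'^* z y^* and q = y^* z y'^* z', where ^* is conjugation, and the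
    statement follows from two equivalences that both hinge on Re p = Re q.

    First, for unit p and q, the map x |-> p x q is a simple rotation iff
    Re p = Re q ([simple_rotationP]). A simple rotation fixes some nonzero x,
    and p x q = x makes q conjugate to p^*, which has the real part of p.
    Conversely, unit quaternions with equal real parts are conjugate
    ([unit_conjugate_of_real_part_eq]): p y = y q with y of norm 1. Then
    p = (p y) y^* and q = y^* (p y), so x |-> p x q is the reflection in the
    hyperplane normal to y followed by the one in the hyperplane normal to p y,
    and a product of two reflections is a simple rotation
    ([reflq_comp_simple]).

    Second, Re q - Re p, as a function of (y, z, y', z'), is an alternating
    quadrilinear form on R^4, hence a multiple of the determinant, and the
    factor is 2 ([det_column_matrix]). So Re p = Re q iff y, z, y', z' are
    linearly dependent, iff some nonzero x is orthogonal to all four of them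
    ([common_normalP]). The vectors orthogonal to y and z form the invariant
    plane of f, and those orthogonal to y' and z' that of g, so such an x is
    exactly a nonzero common point of the two planes. When f or g is the
    identity and its plane is a hyperplane, the same argument applies. *)

Lemma normq_eq0 (R : realType) (x : quat R) : (normq x == 0) = (x == 0).
Proof.
apply/eqP/eqP => [x0|->]; last by rewrite /normq /= expr0n /= !addr0.
have : normq x == 0 by apply/eqP.
rewrite /normq !paddr_eq0 ?addr_ge0 ?sqr_ge0 // !sqrf_eq0.
move=> /andP[/andP[/andP[/eqP x0' /eqP x1'] /eqP x2'] /eqP x3'].
exact: quatP.
Qed.

Lemma normqM (R : realType) (x y : quat R) :
  normq (x * y) = normq x * normq y.
Proof. by rewrite /normq /=; ring. Qed.

Lemma conjq_mul (R : realType) (x : quat R) :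
  conjq x * x = Quat (normq x) 0 0 0.
Proof. by apply: quatP; rewrite /normq /=; ring. Qed.

Lemma conjq_mul_unit (R : realType) (x : quat R) :
  unitq x -> conjq x * x = 1.
Proof. by move=> Nx; rewrite conjq_mul Nx. Qed.

Lemma mul_conjq_unit (R : realType) (x : quat R) :
  unitq x -> x * conjq x = 1.
Proof. by move=> Nx; rewrite mulq_conj Nx. Qed.

Lemma unitqM (R : realType) (x y : quat R) :
  unitq x -> unitq y -> unitq (x * y).
Proof. by rewrite /unitq normqM => -> ->; rewrite mulr1. Qed.

Lemma unitq_conj (R : realType) (x : quat R) : unitq x -> unitq (conjq x).
Proof. by rewrite /unitq /normq /= !sqrrN. Qed.

Lemma normqZ (R : realType) (s : R) (x : quat R) :
  normq (s *: x) = s ^+ 2 * normq x.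
Proof. by rewrite /normq /=; ring. Qed.

Lemma normq_ge0 (R : realType) (x : quat R) : 0 <= normq x.
Proof. by rewrite /normq !addr_ge0 ?sqr_ge0. Qed.

Lemma unitq_normalize (R : realType) (x : quat R) :
  x != 0 -> unitq ((Num.sqrt (normq x))^-1 *: x).
Proof.
move=> x0; rewrite /unitq normqZ exprVn sqr_sqrtr ?normq_ge0 //.
by rewrite mulVf // normq_eq0.
Qed.

(** The hypothesis gives q = x^-1 p^* x, and conjugate quaternions have the same
    real part. *)
Lemma real_part_eq_of_fixed (R : realType) (p q x : quat R) :
  unitq p -> x != 0 -> p * x * q = x -> q0 p = q0 q.
Proof.
move=> Np x0 fx.
have xq : x * q = conjq p * x.
  by rewrite -{2}fx !mulrA conjq_mul_unit // mul1r.
have /(congr1 (@q0 R)) : x * q * conjq x = conjq p * (x * conjq x).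
  by rewrite xq mulrA.
rewrite mulq_conj => e.
apply: (@mulfI _ (normq x)); first by rewrite normq_eq0.
transitivity (q0 (conjq p * Quat (normq x) 0 0 0)); first by rewrite /=; ring.
by rewrite -e /normq /=; ring.
Qed.

(** Since p and q are roots of the same quadratic X^2 - 2 (Re p) X + 1, every
    y = p w - w q^* satisfies p y = y q. Some w makes y nonzero, unless p = q^*
    is central, and then p = q. *)
Lemma unit_conjugate_of_real_part_eq (R : realType) (p q : quat R) :
  unitq p -> unitq q -> q0 p = q0 q -> exists2 y, unitq y & p * y = y * q.
Proof.
move=> Np Nq pq.
suff [y y0 e] : exists2 y, y != 0 & p * y = y * q.
  exists ((Num.sqrt (normq y))^-1 *: y); first exact: unitq_normalize.
  set s := _^-1; transitivity (s *: (p * y)); last rewrite e;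
    by apply: quatP => /=; ring.
have [comm|/existsNP[w /eqP w0]] := pselect (forall w, p * w = w * conjq q).
  exists 1; first exact: oner_neq0.
  rewrite mulr1 mul1r.
  (* p commutes with i and j, so its vector part vanishes. *)
  have pE := comm 1; rewrite mulr1 mul1r in pE.
  have ci := comm (Quat 0 1 0 0); have cj := comm (Quat 0 0 1 0).
  rewrite -pE in ci cj.
  have h2 : q2 p = 0 by move: (congr1 (@q3 R) ci) => /=; lra.
  have h3 : q3 p = 0 by move: (congr1 (@q2 R) ci) => /=; lra.
  have h1 : q1 p = 0 by move: (congr1 (@q3 R) cj) => /=; lra.
  have -> : q = conjq p by rewrite pE; apply: quatP; rewrite /= ?opprK.
  by apply: quatP; rewrite /= ?h1 ?h2 ?h3 ?oppr0.
exists (p * w - w * conjq q); first by rewrite subr_eq0.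
apply/eqP; rewrite -subr_eq0; apply/eqP.
transitivity ((normq q - normq p) *: w + (2 * (q0 p - q0 q)) *: (p * w)).
  by apply: quatP; rewrite /normq /=; ring.
by rewrite Np Nq pq !subrr mulr0 !scale0r addr0.
Qed.

(** Gram-Schmidt. The sine is taken to be the norm of the component of z
    orthogonal to y, hence nonnegative, so that t can be an arccosine. *)
Lemma orthonormal_decomposition (R : realType) (y z : quat R) :
  unitq y -> unitq z -> exists (v : quat R) (t : R),
    [/\ unitq v, dotq y v = 0 & z = cos t *: y + sin t *: v].
Proof.
move=> Ny Nz; pose A := dotq z y; pose v' := z - A *: y.
have Nv' : normq v' = 1 - A ^+ 2.
  transitivity (normq z + A ^+ 2 * normq y - 2 * A * dotq z y).
    by rewrite /v' /normq /dotq /=; ring.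
  by rewrite Ny Nz -/A; ring.
have yv' : dotq y v' = 0.
  transitivity (dotq z y - A * normq y); last by rewrite Ny mulr1 subrr.
  by rewrite /v' /normq /dotq /=; ring.
have A2 : A ^+ 2 <= 1 by rewrite -subr_ge0 -Nv' normq_ge0.
have A1 : -1 <= A <= 1.
  by rewrite -ler_norml -(expr_le1 (ltn0Sn 1)) ?normr_ge0 //;
    rewrite real_normK ?num_real.
have [v [Nv yv zE]] : exists v, [/\ unitq v, dotq y v = 0 &
    v' = Num.sqrt (normq v') *: v].
  have [v'0|v'0] := eqVneq v' 0.
    (* When z = y or z = - y, any unit normal to y will do, for instance i y. *)
    exists (Quat 0 1 0 0 * y); split.
    - by apply: unitqM => //; rewrite /unitq /normq /=; ring.
    - by rewrite /dotq /=; ring.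
    - by rewrite v'0 (eqP (_ : normq 0 == 0)) ?normq_eq0 // sqrtr0 scale0r.
  exists ((Num.sqrt (normq v'))^-1 *: v'); split.
  - exact: unitq_normalize.
  - rewrite -[RHS](mulr0 (Num.sqrt (normq v'))^-1) -yv'.
    by rewrite /dotq /=; ring.
  - by rewrite scalerA divff ?scale1r // sqrtr_eq0 -ltNge lt_def
      normq_eq0 v'0 normq_ge0.
exists v, (acos A); split=> //.
by rewrite acosK // sin_acos // -Nv' -zE addrC subrK.
Qed.

(** The two reflections turn the plane of y and z by twice the angle t from y
    to z. *)
Lemma reflq_comp_simple (R : realType) (y z : quat R) :
  unitq y -> unitq z -> simple_rotation (reflq z \o reflq y).
Proof.
move=> Ny Nz.
have [v [t [Nv yv zE]]] := orthonormal_decomposition Ny Nz.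
exists y, v, (t + t); split=> // s r w wy wv.
rewrite /comp !reflqE //; set x := s *: y + r *: v + w.
have xy : dotq x y = s.
  transitivity (s * normq y + r * dotq y v + dotq w y).
    by rewrite /x /normq /dotq /=; ring.
  by rewrite Ny yv wy; ring.
have xv : dotq x v = r.
  transitivity (r * normq v + s * dotq y v + dotq w v).
    by rewrite /x /normq /dotq /=; ring.
  by rewrite Nv yv wv; ring.
have AB := cos2Dsin2 t; rewrite cosD sinD xy.
set A := cos t in zE AB *; set B := sin t in zE AB *.
have -> : dotq (x - (2 * s) *: y) z = B * r - A * s.
  transitivity (A * dotq x y + B * dotq x v - 2 * s * A * normq y
                - 2 * s * B * dotq y v).
    by rewrite zE /normq /dotq /=; ring.
  by rewrite xy xv Ny yv; ring.
have A2 : A ^+ 2 = 1 - B ^+ 2 by rewrite -AB addrK.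
by rewrite zE /x; apply: quatP => /=; ring: A2.
Qed.

Definition column_matrix (R : realType) (a b c d : quat R) : 'M[R]_4 :=
  \matrix_(i, j)
    let x := nth 0 [:: a; b; c; d] j in [:: q0 x; q1 x; q2 x; q3 x]`_i.

(** The right-hand side vanishes when two consecutive arguments are equal: a
    product such as a^* a is a real number, and once it is pulled out of both
    terms they are the real parts of x y and y x, which agree. An alternating
    quadrilinear form on R^4 is a multiple of the determinant, and (1, i, j, k)
    gives the factor 2. *)
Lemma det_column_matrix (R : realType) (a b c d : quat R) :
  2 * \det (column_matrix a b c d) =
  q0 (conjq a * b * (conjq c * d)) - q0 (d * conjq c * (b * conjq a)).
Proof.
rewrite (expand_det_row _ ord0) !big_ord_recl big_ord0 /cofactor.
rewrite !(expand_det_row _ ord0) !big_ord_recl !big_ord0 /cofactor.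
rewrite !(expand_det_row _ ord0) !big_ord_recl !big_ord0 /cofactor.
by rewrite !det_mx11 !mxE /= /bump /=; ring.
Qed.

(** A row vector times [column_matrix a b c d] lists its scalar products with
    a, b, c and d, so common normals are the kernel vectors of that matrix, and
    nonzero ones exist iff its determinant vanishes. *)
Lemma common_normalP (R : realType) (a b c d : quat R) :
  q0 (d * conjq c * (b * conjq a)) = q0 (conjq a * b * (conjq c * d)) <->
  exists2 x, x != 0 &
    [/\ dotq a x = 0, dotq b x = 0, dotq c x = 0 & dotq d x = 0].
Proof.
have mulE (v : 'rV[R]_4) j : (v *m column_matrix a b c d) 0 j =
    dotq (nth 0 [:: a; b; c; d] j)
         (Quat (v 0 0) (v 0 1) (v 0 2%:R) (v 0 3%:R)).
  rewrite mxE !big_ord_recl big_ord0 !mxE /=.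
  have -> : lift ord0 ord0 = 1 :> 'I_4 by apply: val_inj.
  have -> : lift ord0 (lift ord0 ord0) = 2%:R :> 'I_4 by apply: val_inj.
  have -> : lift ord0 (lift ord0 (lift ord0 ord0)) = 3%:R :> 'I_4
    by apply: val_inj.
  by rewrite /dotq /=; ring.
have -> : q0 (d * conjq c * (b * conjq a)) = q0 (conjq a * b * (conjq c * d))
    <-> \det (column_matrix a b c d) == 0.
  split=> [e|/eqP e].
    have /eqP := det_column_matrix a b c d.
    by rewrite e subrr mulf_eq0 pnatr_eq0.
  have := det_column_matrix a b c d; rewrite e mulr0 => /esym/eqP.
  by rewrite subr_eq0 => /eqP.
split=> [/det0P[v v0 /rowP ve]|[x x0 [ax bx cx dx]]].
  exists (Quat (v 0 0) (v 0 1) (v 0 2%:R) (v 0 3%:R)).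
    apply: contra_neq v0 => -[v0 v1 v2 v3].
    apply/rowP => -[[|[|[|[|//]]]] ?]; rewrite mxE;
      [rewrite -[RHS]v0|rewrite -[RHS]v1|rewrite -[RHS]v2|rewrite -[RHS]v3];
      by congr (v _ _); apply: val_inj.
  have := ve 0; have := ve 1; have := ve 2%:R; have := ve 3%:R.
  by rewrite !mulE !mxE /=; split.
apply/det0P; exists (\row_j [:: q0 x; q1 x; q2 x; q3 x]`_j).
  apply: contra_neq x0 => /rowP x0.
  by apply: quatP; [have := x0 0|have := x0 1|have := x0 2%:R|have := x0 3%:R];
    rewrite !mxE.
apply/rowP => j; rewrite mulE !mxE /=.
have -> : Quat (q0 x) (q1 x) (q2 x) (q3 x) = x by case: (x).
by case: j => -[|[|[|[|//]]]] ?.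
Qed.

Lemma reflq_comp (R : realType) (y z x : quat R) :
  reflq z (reflq y x) = z * conjq y * x * (conjq y * z).
Proof. by rewrite /reflq; apply: quatP => /=; ring. Qed.

(** Every vector orthogonal to the plane of rotation is fixed. Such a nonzero
    vector exists because the quadruple (u, v, u, v) is linearly dependent. *)
Lemma simple_rotation_fixes (R : realType) (f : quat R -> quat R) :
  simple_rotation f -> exists2 x, x != 0 & f x = x.
Proof.
move=> [u [v [t [_ _ _ fE]]]].
have [|x x0 [ux vx _ _]] := (common_normalP u v u v).1.
  by rewrite /=; ring.
exists x => //.
have := fE 0 0 x; rewrite !scale0r !add0r; apply.
  by rewrite -ux /dotq; ring.
by rewrite -vx /dotq; ring.
Qed.

Lemma simple_rotationP (R : realType) (p q : quat R) :
  unitq p -> unitq q ->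
  simple_rotation (fun x => p * x * q) <-> q0 p = q0 q.
Proof.
move=> Np Nq; split=> [/simple_rotation_fixes[x x0 fx]|pq].
  exact: real_part_eq_of_fixed fx.
have [y Ny e] := unit_conjugate_of_real_part_eq Np Nq pq.
have -> : (fun x => p * x * q) = reflq (p * y) \o reflq y.
  apply: funext => x; rewrite /= reflq_comp -(mulrA p y) mul_conjq_unit // mulr1.
  by rewrite e (mulrA (conjq y)) conjq_mul_unit // mul1r.
by apply: reflq_comp_simple => //; apply: unitqM.
Qed.

Theorem corollary1 (R : realType) (a b c d : quat R) (f g : quat R -> quat R)
  (Pf Pg : set (quat R)) :
  unitq a -> unitq b -> unitq c -> unitq d ->
  (forall x, f x = a * x * b) -> (forall x, g x = c * x * d) ->
  simple_rotation f -> simple_rotation g ->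
  invariant_plane f Pf -> invariant_plane g Pg ->
  (simple_rotation (g \o f) <-> Pf `&` Pg <> [set 0]).
Proof.
move=> _ _ _ _ _ _ _ _ [y [z [Ny Nz fE ->]]] [y' [z' [Ny' Nz' gE ->]]].
have -> : g \o f = fun x =>
    (z' * conjq y' * (z * conjq y)) * x * ((conjq y * z) * (conjq y' * z')).
  by apply: funext => x; rewrite /= fE gE /= !reflq_comp !mulrA.
rewrite simple_rotationP; do ?[exact: unitq_conj|apply: unitqM => //].
rewrite common_normalP.
have dot0 (w : quat R) : dotq w 0 = 0 by rewrite /dotq /=; ring.
split=> [[x x0 [yx zx y'x z'x]] e|ne].
  have : [set 0] x by rewrite -e.
  by move=> /= xe; rewrite xe eqxx in x0.
apply: contrapT => nex; apply: ne; apply/seteqP; split=> x /=.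
  move=> [[yx zx] [y'x z'x]]; apply: contrapT => /eqP x0.
  by apply: nex; exists x.
by move=> ->; rewrite !dot0.
Qed.
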